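(* There exists a quartic polynomial $F\colon\mathbb{R}^{3\times 3}_{\mathrm{sym}}\to\mathbb{R}$ (a polynomial of degree $4$ in the matrix entries) which is convex along every symmetric rank-one direction, i.e. $t\mapsto F(A+t\,a\otimes a)$ is convex on $\mathbb{R}$ for every $A\in\mathbb{R}^{3\times 3}_{\mathrm{sym}}$ and every $a\in\mathbb{R}^3$, but which is not Hessian-quasiconvex at $0$: there is a real-valued $\Psi\in C^\infty(\mathbb{T}^3)$ with $$\frac{1}{|\mathbb{T}^3|}\int_{\mathbb{T}^3}F(D^2\Psi)\,dx<F(0).$$
   Context: $\mathbb{R}^{3\times 3}_{\mathrm{sym}}$ is the space of real symmetric $3\times 3$ matrices, $a\otimes a=aa^T$, $\mathbb{T}^3$ is the periodic torus (e.g. $\mathbb{R}^3/(2\pi\mathbb{Z})^3$), and $D^2\Psi$ is the Hessian matrix of $\Psi$. *)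

(* Defs.v *)
From HB Require Import structures.
From mathcomp Require Import all_boot all_order all_algebra.
From mathcomp Require Import all_classical all_reals all_analysis.
From mathcomp Require mpoly.
(* The notations of mpoly clash with those of all_analysis. *)
Import -(notations) mpoly.
Set Implicit Arguments.
Unset Strict Implicit.
Unset Printing Implicit Defensive.
Import Order.TTheory GRing.Theory Num.Theory.
Import numFieldNormedType.Exports.
Local Open Scope classical_set_scope.
Local Open Scope ring_scope.

Section Definitions.
Variable R : realType.

(* A function on symmetric matrices is modelled by a function on 'M[R]_3 whose
   values at non-symmetric matrices are irrelevant: every condition below only
   involves its values at symmetric ones (Hessians of smooth functions are
   symmetric). *)

(* The entries on and above the diagonal are linear coordinates on the space of
   symmetric matrices. *)
Definition sym_entries (A : 'M[R]_3) : 'I_6 -> R :=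
  tnth [tuple A 0 0; A 0 1; A 0 2; A 1 1; A 1 2; A 2 2].

(* msize is 1 + the total degree. With the 6 independent entries as variables,
   the degree is that of the function: in 9 variables, (x_01 - x_10)^4 has
   degree 4 but vanishes on symmetric matrices. *)
Definition quartic_on_sym (F : 'M[R]_3 -> R) : Prop :=
  exists2 p : mpoly.mpoly 6 R, mpoly.msize p = 5%N &
    forall A : 'M[R]_3, A \is symmetricmx ->
      F A = mpoly.meval (sym_entries A) p.

Definition sym_rank_one_convex (F : 'M[R]_3 -> R) : Prop :=
  forall (A : 'M[R]_3) (a : 'cV[R]_3), A \is symmetricmx ->
    convex_function (E := R^o) setT (fun t : R => F (A + t *: (a *m a^T))).

Definition partial (i : 'I_3) (f : 'rV[R]_3 -> R) : 'rV[R]_3 -> R :=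
  fun x => 'D_(delta_mx 0 i) f x.

(* C^oo: iterated partial derivatives of all orders exist and are continuous. *)
Definition smooth (f : 'rV[R]_3 -> R) : Prop :=
  forall s : seq 'I_3,
    continuous (foldr partial f s) /\
    forall (i : 'I_3) (x : 'rV[R]_3),
      derivable (foldr partial f s) x (delta_mx 0 i).

(* C^oo functions on the torus R^3 / (2 pi Z)^3, as periodic functions on R^3. *)
Definition smooth_torus (f : 'rV[R]_3 -> R) : Prop :=
  smooth f /\ forall i : 'I_3, periodic f ((2 * pi) *: delta_mx 0 i).

Definition hessian (f : 'rV[R]_3 -> R) (x : 'rV[R]_3) : 'M[R]_3 :=
  \matrix_(i, j) partial i (partial j f) x.

(* Row vectors carry no Lebesgue measure in the library, hence triples; as a type
   measurableTypeR R is R, with the Borel sigma-algebra. *)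
Local Notation triple :=
  (measurableTypeR R * measurableTypeR R * measurableTypeR R)%type.

Definition lebesgue3 : {measure set triple -> \bar R} :=
  ((@lebesgue_measure R \x @lebesgue_measure R) \x @lebesgue_measure R)%E.

Definition row3 (x : triple) : 'rV[R]_3 :=
  \row_i tnth [tuple x.1.1; x.1.2; x.2] i.

(* A fundamental domain of the torus, up to a null set. *)
Definition torus_cell : set triple :=
  `[0, 2 * pi] `*` `[0, 2 * pi] `*` `[0, 2 * pi].

Definition torus_mean (f : 'rV[R]_3 -> R) : R :=
  (fine (lebesgue3 torus_cell))^-1 *
  \int[lebesgue3]_(x in torus_cell) f (row3 x).

End Definitions.

(* Main.v *)
From HB Require Import structures.
Require Import Defs.
From mathcomp Require Import all_boot all_order all_algebra.
From mathcomp Require Import all_classical all_reals all_analysis.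
From mathcomp Require Import measurable_realfun ring lra.
From mathcomp Require mpoly.
Set Implicit Arguments.
Unset Strict Implicit.
Unset Printing Implicit Defensive.
Import Order.TTheory GRing.Theory Num.Theory.
Import numFieldNormedType.Exports.
Local Open Scope classical_set_scope.
Local Open Scope ring_scope.

(** The example rests on four wave vectors in the integer lattice that sum up
to zero after changing one sign: e_1, e_2, e_3 and e = e_1 + e_2 + e_3. Let L be
the span of the four matrices e_i e_i^T and e e^T, with coordinates
x_1, x_2, x_3, x_4. A matrix of L has all its off-diagonal entries equal to
x_4, and this forces a rank-one matrix of L to be a multiple of one of the four
generators. So the function - x_1 x_2 x_3 x_4 is affine along all rank-one
directions of L, whereas along the Hessian of
Psi = - (cos x + cos y + cos z + cos (x + y + z)), which stays in L and has the
four cosines as coordinates, its mean is - 1/8, because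
cos x cos y cos z cos (x + y + z) has mean 1/8: this is where the linear relation
between the wave vectors enters.

It remains to extend - x_1 x_2 x_3 x_4 to all symmetric matrices without
destroying rank-one convexity. Complete the coordinates of L by n_1, n_2, which
vanish exactly on L, and take
F = (|x|^2 + c |n|^2)^2 - K x_1 x_2 x_3 x_4. For a rank-one direction
with coordinates (m, n), the vanishing of the 2 x 2 minors writes each product
m_i m_j with i <> j as a combination of products n_k m_l and n_k n_l
([rank_one_coord_products]). By the inequality of arithmetic and geometric
means, |m_i m_j| is then at most a small multiple of |m|^2 + c |n|^2 once c is
large. The second derivative of K x_1 x_2 x_3 x_4 involves only these products,
and is dominated by that of the squared quadratic form ([quartic_d2_ge0]).

The square costs at most 16 in the mean, since each of the four cosines
has square at most 1, while the product gains K / 8. The choice K = 256, for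
which c = 2 ^ 15 is large enough, gives a mean of at most - 16 < 0 = F 0. *)

(** * Convexity of quartic polynomials in one variable *)

(** The second derivative is quadratic in [t], so the integral remainder of
Taylor's formula is computed exactly by a quadrature rule with the two nodes
[w] and [(z + w) / 2] and the positive weights 1/6 and 1/3. Hence the graph
lies above its tangents. *)
Lemma quartic_poly_convex (R : realFieldType) (c0 c1 c2 c3 c4 : R)
    (f := fun t : R => c0 + c1 * t + c2 * t ^+ 2 + c3 * t ^+ 3 + c4 * t ^+ 4) :
    (forall t, 0 <= 2 * c2 + 6 * c3 * t + 12 * c4 * t ^+ 2) ->
  forall s u v, 0 <= s -> s <= 1 ->
  f (s * u + (1 - s) * v) <= s * f u + (1 - s) * f v.
Proof.
move=> f2ge0 s u v s0 s1.
have tangent w z :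
    f w + (c1 + 2 * c2 * w + 3 * c3 * w ^+ 2 + 4 * c4 * w ^+ 3) * (z - w)
    <= f z.
  have -> : f z = f w
      + (c1 + 2 * c2 * w + 3 * c3 * w ^+ 2 + 4 * c4 * w ^+ 3) * (z - w)
      + (z - w) ^+ 2 *
        ((2 * c2 + 6 * c3 * w + 12 * c4 * w ^+ 2) / 6 +
         (2 * c2 + 6 * c3 * ((z + w) / 2) + 12 * c4 * ((z + w) / 2) ^+ 2) / 3).
    by rewrite /f; field.
  by rewrite lerDl mulr_ge0 ?sqr_ge0// addr_ge0// divr_ge0.
set w := s * u + (1 - s) * v.
set p := c1 + 2 * c2 * w + 3 * c3 * w ^+ 2 + 4 * c4 * w ^+ 3.
have -> : f w = s * (f w + p * (u - w)) + (1 - s) * (f w + p * (v - w)).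
  by rewrite /w; ring.
by rewrite lerD// ler_wpM2l ?subr_ge0//; exact: tangent.
Qed.

(** * The quartic form in adapted coordinates *)

Definition wnorm (R : pzSemiRingType) (x1 x2 x3 x4 n1 n2 : R) : R :=
  x1 ^+ 2 + x2 ^+ 2 + x3 ^+ 2 + x4 ^+ 2 + 2 ^+ 15 * (n1 ^+ 2 + n2 ^+ 2).

(** The ring is arbitrary in order to evaluate the form both on numbers and on
polynomial variables. *)
Definition quartic (R : pzRingType) (x1 x2 x3 x4 n1 n2 : R) : R :=
  wnorm x1 x2 x3 x4 n1 n2 ^+ 2 - 256 * (x1 * x2 * x3 * x4).

Section QuarticForm.
Variable R : realFieldType.

Lemma wnorm_ge0 (x1 x2 x3 x4 n1 n2 : R) : 0 <= wnorm x1 x2 x3 x4 n1 n2.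
Proof.
by rewrite /wnorm !addr_ge0 ?sqr_ge0 ?mulr_ge0 ?exprn_ge0 ?addr_ge0 ?sqr_ge0.
Qed.

Lemma normM2_le (a b : R) : 2 * `|a * b| <= a ^+ 2 + b ^+ 2.
Proof.
have := sqr_ge0 (a - b); have := sqr_ge0 (a + b).
by case: (ger0P (a * b)) => ?; lra.
Qed.

(** Each variable occurs in three of the six pairs, whence the factor 3 / 2. *)
Lemma pair_form_le (x1 x2 x3 x4 p12 p13 p14 p23 p24 p34 b : R) :
  `|p12| <= b -> `|p13| <= b -> `|p14| <= b ->
  `|p23| <= b -> `|p24| <= b -> `|p34| <= b ->
  p12 * x3 * x4 + p13 * x2 * x4 + p14 * x2 * x3
  + p23 * x1 * x4 + p24 * x1 * x3 + p34 * x1 * x2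
  <= 3 / 2 * b * (x1 ^+ 2 + x2 ^+ 2 + x3 ^+ 2 + x4 ^+ 2).
Proof.
have K p x y : `|p| <= b -> p * x * y <= b / 2 * (x ^+ 2 + y ^+ 2).
  move=> pb; rewrite -mulrA; apply: (le_trans (ler_norm _)); rewrite normrM.
  have := normM2_le x y; have := normr_ge0 (x * y); have := normr_ge0 p; nra.
move=> /K K1 /K K2 /K K3 /K K4 /K K5 /K K6.
have := K1 x3 x4; have := K2 x2 x4; have := K3 x2 x3.
have := K4 x1 x4; have := K5 x1 x3; have := K6 x1 x2; lra.
Qed.

(** Here [m1], ..., [n2] are the adapted coordinates of a a^T. The products
vanish on L because a a^T is then a multiple of one of the generators; off L, the
identities [e12], ..., [e34] express them through [n1] and [n2], with
coefficients that are linear in the coordinates. *)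
Lemma rank_one_coord_products (a1 a2 a3 : R)
    (m1 := a1 * a1 - a1 * a2) (m2 := a2 * a2 - a1 * a2)
    (m3 := a3 * a3 - a1 * a2) (m4 := a1 * a2)
    (n1 := a1 * a3 - a1 * a2) (n2 := a2 * a3 - a1 * a2)
    (b := wnorm m1 m2 m3 m4 n1 n2 / 192) :
  [/\ `|m1 * m2| <= b, `|m1 * m3| <= b & `|m1 * m4| <= b] /\
  [/\ `|m2 * m3| <= b, `|m2 * m4| <= b & `|m3 * m4| <= b].
Proof.
have e12 : m1 * m2 = m1 * n2 + m2 * n1 by rewrite /m1 /m2 /n1 /n2; ring.
have e13 : m1 * m3 = m1 * n2 + n1 ^+ 2 - n1 * n2.
  by rewrite /m1 /m3 /n1 /n2; ring.
have e23 : m2 * m3 = m2 * n1 + n2 ^+ 2 - n1 * n2.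
  by rewrite /m2 /m3 /n1 /n2; ring.
have e14 : m1 * m4 = m4 * (n1 - n2) - m1 * n2.
  by rewrite /m1 /m4 /n1 /n2; ring.
have e24 : m2 * m4 = m4 * (n2 - n1) - m2 * n1.
  by rewrite /m2 /m4 /n1 /n2; ring.
have e34 : m3 * m4 = m4 * (n1 + n2) + n1 * n2.
  by rewrite /m3 /m4 /n1 /n2; ring.
have := sqr_ge0 m1; have := sqr_ge0 m2; have := sqr_ge0 m3; have := sqr_ge0 m4.
(* The weights 1/192 and 48 have product 1/4. In each
   case the terms without any m add up to at most 144 (n1 ^ 2 + n2 ^ 2), and
   144 < 2 ^ 15 / 192. *)
have AGM (m n : R) : - (m ^+ 2 / 192 + 48 * n ^+ 2) <= m * n /\
    m * n <= m ^+ 2 / 192 + 48 * n ^+ 2.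
  have := sqr_ge0 (m / 96 - n); have := sqr_ge0 (m / 96 + n); lra.
rewrite e12 e13 e14 e23 e24 e34 /b /wnorm !ler_norml.
clear e12 e13 e14 e23 e24 e34.
have [] := AGM m1 n2; have [] := AGM m2 n1.
have [] := AGM m4 (n1 - n2); have [] := AGM m4 (n1 + n2).
have := sqr_ge0 n1; have := sqr_ge0 n2.
have := sqr_ge0 (n1 - n2); have := sqr_ge0 (n1 + n2).
clearbody m1 m2 m3 m4 n1 n2.
by move=> *; repeat split; apply/andP; split; lra.
Qed.

(** The expression is the second derivative of [quartic] at (x, y) in the
direction of a a^T. Its first term alone outweighs the last one:
512 * (3 / 2) / 192 = 4. *)
Lemma quartic_d2_ge0 (x1 x2 x3 x4 y1 y2 a1 a2 a3 : R)
    (m1 := a1 * a1 - a1 * a2) (m2 := a2 * a2 - a1 * a2)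
    (m3 := a3 * a3 - a1 * a2) (m4 := a1 * a2)
    (n1 := a1 * a3 - a1 * a2) (n2 := a2 * a3 - a1 * a2) :
  0 <= 4 * wnorm x1 x2 x3 x4 y1 y2 * wnorm m1 m2 m3 m4 n1 n2
     + 8 * (x1 * m1 + x2 * m2 + x3 * m3 + x4 * m4
            + 2 ^+ 15 * (y1 * n1 + y2 * n2)) ^+ 2
     - 512 * (m1 * m2 * x3 * x4 + m1 * m3 * x2 * x4 + m1 * m4 * x2 * x3
              + m2 * m3 * x1 * x4 + m2 * m4 * x1 * x3 + m3 * m4 * x1 * x2).
Proof.
have [[b12 b13 b14] [b23 b24 b34]] := rank_one_coord_products a1 a2 a3.
set Q := wnorm m1 m2 m3 m4 n1 n2; set E := _ + m3 * m4 * x1 * x2.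
have EQ : E <= 3 / 2 * (Q / 192) * (x1 ^+ 2 + x2 ^+ 2 + x3 ^+ 2 + x4 ^+ 2).
  exact: pair_form_le.
have QX : 0 <= Q * (2 ^+ 15 * (y1 ^+ 2 + y2 ^+ 2)).
  apply: mulr_ge0; first exact: wnorm_ge0.
  apply: mulr_ge0; first exact: exprn_ge0.
  by apply: addr_ge0; exact: sqr_ge0.
have := sqr_ge0 (x1 * m1 + x2 * m2 + x3 * m3 + x4 * m4
                 + 2 ^+ 15 * (y1 * n1 + y2 * n2)).
set B := _ ^+ 2 => B0.
rewrite /wnorm; clearbody Q E B; clear -EQ QX B0.
lra.
Qed.

End QuarticForm.

(** * The function on matrices *)

(** The first four arguments are the coordinates in the basis e_1 e_1^T,
e_2 e_2^T, e_3 e_3^T, e e^T of L; the last two vanish exactly on L. *)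
Definition energy (R : realType) (A : 'M[R]_3) : R :=
  quartic (A 0 0 - A 0 1) (A 1 1 - A 0 1) (A 2 2 - A 0 1) (A 0 1)
    (A 0 2 - A 0 1) (A 1 2 - A 0 1).

Lemma energy_rank_one_convex (R : realType) : sym_rank_one_convex (@energy R).
Proof.
move=> A a _ s u v _ _.
rewrite convRE.
pose f (t : R) := energy (A + t *: (a *m a^T)).
suff fcvx (r p q : R) : 0 <= r -> r <= 1 ->
    f (r * p + (1 - r) * q) <= r * f p + (1 - r) * f q.
  exact: (fcvx s%:num u v).
set a1 := a 0 0; set a2 := a 1 0; set a3 := a 2 0.
have lineE t i j : (A + t *: (a *m a^T)) i j = A i j + t * (a i 0 * a j 0).
  by rewrite !mxE big_ord1 mxE.
set x1 := A 0 0 - A 0 1; set x2 := A 1 1 - A 0 1; set x3 := A 2 2 - A 0 1.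
set x4 := A 0 1; set y1 := A 0 2 - A 0 1; set y2 := A 1 2 - A 0 1.
pose m1 := a1 * a1 - a1 * a2; pose m2 := a2 * a2 - a1 * a2.
pose m3 := a3 * a3 - a1 * a2; pose m4 := a1 * a2.
pose n1 := a1 * a3 - a1 * a2; pose n2 := a2 * a3 - a1 * a2.
pose q0 := wnorm x1 x2 x3 x4 y1 y2.
pose q1 := x1 * m1 + x2 * m2 + x3 * m3 + x4 * m4
           + 2 ^+ 15 * (y1 * n1 + y2 * n2).
pose q2 := wnorm m1 m2 m3 m4 n1 n2.
pose c0 := q0 ^+ 2 - 256 * (x1 * x2 * x3 * x4).
pose c1 := 4 * q0 * q1 -
  256 * (m1 * x2 * x3 * x4 + x1 * m2 * x3 * x4
         + x1 * x2 * m3 * x4 + x1 * x2 * x3 * m4).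
pose c2 := 2 * q0 * q2 + 4 * q1 ^+ 2 -
  256 * (m1 * m2 * x3 * x4 + m1 * m3 * x2 * x4 + m1 * m4 * x2 * x3
         + m2 * m3 * x1 * x4 + m2 * m4 * x1 * x3 + m3 * m4 * x1 * x2).
pose c3 := 4 * q1 * q2 -
  256 * (x1 * m2 * m3 * m4 + m1 * x2 * m3 * m4
         + m1 * m2 * x3 * m4 + m1 * m2 * m3 * x4).
pose c4 := q2 ^+ 2 - 256 * (m1 * m2 * m3 * m4).
have fE t : f t = c0 + c1 * t + c2 * t ^+ 2 + c3 * t ^+ 3 + c4 * t ^+ 4.
  transitivity (quartic (x1 + t * m1) (x2 + t * m2) (x3 + t * m3) (x4 + t * m4)
                  (y1 + t * n1) (y2 + t * n2)).
    rewrite /f /energy !lineE -/a1 -/a2 -/a3 /x1 /x2 /x3 /x4 /y1 /y2.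
    by rewrite /m1 /m2 /m3 /m4 /n1 /n2; congr quartic; ring.
  rewrite /c0 /c1 /c2 /c3 /c4 /q0 /q1 /q2 /quartic /wnorm.
  by move: (2 ^+ 15) => c; ring.
rewrite !fE; apply: quartic_poly_convex => t.
have := quartic_d2_ge0 (x1 + t * m1) (x2 + t * m2) (x3 + t * m3) (x4 + t * m4)
  (y1 + t * n1) (y2 + t * n2) a1 a2 a3.
congr (0 <= _).
rewrite -/m1 -/m2 -/m3 -/m4 -/n1 -/n2 /c2 /c3 /c4 /q0 /q1 /q2 /wnorm.
by move: (2 ^+ 15) => c; ring.
Qed.

Lemma energy0 (R : realType) : energy 0 = 0 :> R.
Proof.
by rewrite /energy /quartic /wnorm !mxE !(subr0, expr0n, mulr0, addr0).
Qed.

Lemma rmorph_quartic (S T : pzRingType) (f : {rmorphism S -> T})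
    (x1 x2 x3 x4 n1 n2 : S) :
  f (quartic x1 x2 x3 x4 n1 n2) =
  quartic (f x1) (f x2) (f x3) (f x4) (f n1) (f n2).
Proof.
rewrite /quartic /wnorm rmorphB rmorphXn !rmorphM rmorph_nat !rmorphD /=.
by rewrite rmorphM /= rmorphD !rmorphXn rmorph_nat.
Qed.

Section PolynomialDegree.
Import -(notations) mpoly.

Lemma dhomog_quartic (S : nzRingType) k (x1 x2 x3 x4 n1 n2 : mpoly k S) :
  all (fun p => p \in ishomog1 1 mdeg) [:: x1; x2; x3; x4; n1; n2] ->
  quartic x1 x2 x3 x4 n1 n2 \in ishomog1 4 mdeg.
Proof.
move=> /= /and5P[h1 h2 h3 h4 /and3P[h5 h6 _]].
have hX (u : mpoly k S) :
    u \in ishomog1 1 mdeg -> u ^+ 2 \in ishomog1 2 mdeg.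
  exact: (@dhomogMn _ _ _ 1 _ 2).
have hM d e (u v : mpoly k S) : u \in ishomog1 d mdeg ->
    v \in ishomog1 e mdeg -> u * v \in ishomog1 (d + e) mdeg.
  exact: dhomogM.
have hN d (u : mpoly k S) m :
    u \in ishomog1 d mdeg -> m%:R * u \in ishomog1 d mdeg.
  by rewrite mulr_natl; exact: rpredMn.
rewrite /quartic /wnorm -natrX; apply: rpredB; last first.
  by apply: hN; apply: (hM 3 1) => //; apply: (hM 2 1) => //; exact: (hM 1 1).
apply: (@dhomogMn _ _ _ 2 _ 2).
apply: rpredD; last by apply: hN; apply: rpredD; exact: hX.
by do !apply: rpredD; exact: hX.
Qed.

(** Being homogeneous of degree 4 and not zero, the polynomial has degree
exactly 4. *)
Lemma energy_quartic_on_sym (R : realType) : quartic_on_sym (@energy R).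
Proof.
pose X i : mpoly 6 R := mpolyX R (mnm1 i).
pose p := quartic (X 0 - X 1) (X 3 - X 1) (X 5 - X 1) (X 1)
  (X 2 - X 1) (X 4 - X 1).
have evX v i : meval v (X i) = v i by exact: mevalXU.
have pE v : meval v p =
    quartic (v 0 - v 1) (v 3 - v 1) (v 5 - v 1) (v 1) (v 2 - v 1) (v 4 - v 1).
  by rewrite /p rmorph_quartic !rmorphB /= !evX.
exists p; last by move=> A _; rewrite pE.
have p0 : p != 0.
  (* The form takes the value 1 at the matrix e_1 e_1^T. *)
  apply/eqP => /(congr1 (meval (fun i : 'I_6 => (val i == 0)%N%:R))).
  rewrite pE meval0 /quartic /wnorm /=.
  rewrite !(subr0, expr0n, addr0, mulr0, expr1n) => /eqP.
  by rewrite oner_eq0.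
have hX i : X i \in ishomog1 1 mdeg.
  by rewrite dhomogX; apply/eqP; exact: mdeg1.
have hXB i j : X i - X j \in ishomog1 1 mdeg by apply: rpredB.
have hp : p \in ishomog1 4 mdeg.
  by apply: dhomog_quartic; apply/and5P; split; rewrite ?hXB ?hX /= ?hXB.
by rewrite (mpolySpred mdeg p0) -(dhomog_uniq p0 hp (dhomog_msize hp)).
Qed.

End PolynomialDegree.

(** * Trigonometric sums and the potential *)

Section TrigonometricSums.
Variable R : realType.
Let wave : Type := (R * 'rV[R]_3 * R)%type.
Implicit Types (k x v : 'rV[R]_3) (s : seq wave).

Lemma is_derive_line (f : 'rV[R]_3 -> R) x v (d : R) :
  is_derive (0 : R) 1 (fun h => f (h *: v + x)) d -> is_derive x v f d.
Proof.
move=> [df Df].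
have E : (fun h : R => h^-1 *: ((f \o shift x) (h *: v) - f x)) =
    (fun h : R => h^-1 *: (((fun h => f (h *: v + x)) \o shift (0 : R)) (h *: 1)
                           - f (0 *: v + x))).
  by apply/funext => h /=; rewrite addr0 scale0r add0r [h *: 1]mulr1.
by split; [rewrite /derivable E|rewrite /derive E].
Qed.

Definition dot k x : R := \sum_i k 0 i * x 0 i.

Lemma dotD k x y : dot k (x + y) = dot k x + dot k y.
Proof.
by rewrite /dot -big_split/=; apply: eq_bigr => i _; rewrite mxE mulrDr.
Qed.

Lemma dotZ k x h : dot k (h *: x) = h * dot k x.
Proof.
by rewrite /dot big_distrr/=; apply: eq_bigr => i _; rewrite mxE mulrCA.
Qed.

Lemma dot_delta k i : dot k (delta_mx 0 i) = k 0 i.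
Proof.
rewrite /dot (bigD1 i)//= big1 ?mxE ?eqxx ?mulr1 ?addr0// => j ji.
by rewrite mxE (negbTE ji) andbF mulr0.
Qed.

Lemma continuous_dot k : continuous (dot k).
Proof.
apply: continuous_big => [|i _ x]; first exact: add_continuous.
exact: (cvgM (cvg_cst (k 0 i)) (@coord_continuous _ _ _ 0 i x)).
Qed.

(** A wave is a triple (amplitude, wave vector, phase). The phase is what makes
these sums stable under partial derivatives ([dtrig]): a derivative shifts it by
a quarter of a period. *)
Definition trig s x : R := \sum_(w <- s) w.1.1 * cos (dot w.1.2 x + w.2).

Lemma continuous_trig s : continuous (trig s).
Proof.
apply: continuous_big => [|w _ x]; first exact: add_continuous.
have phase : {for x, continuous (fun y => dot w.1.2 y + w.2)}.
  by apply: continuousD; [exact: continuous_dot|exact: cst_continuous].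
exact: (cvgM (cvg_cst w.1.1) (continuous_comp phase (@continuous_cos _ _))).
Qed.

Definition dtrig (i : 'I_3) s : seq wave :=
  [seq (w.1.1 * w.1.2 0 i, w.1.2, w.2 + pi / 2) | w : wave <- s].

Lemma is_derive_trig s i x :
  is_derive x (delta_mx 0 i) (trig s) (trig (dtrig i s) x).
Proof.
apply: is_derive_line.
elim: s => [|w s IH].
  by rewrite /trig /= big_nil; under eq_fun do rewrite big_nil;
    exact: is_derive_cst.
rewrite /trig /= big_cons; under eq_fun do rewrite big_cons.
apply: is_deriveD => //=.
under eq_fun do rewrite dotD dotZ dot_delta.
rewrite [_ + (_ + pi / 2)]addrA cosDpihalf.
pose g (h : R) := h * w.1.2 0 i + dot w.1.2 x + w.2.
have -> : (fun h : R => w.1.1 * cos (h * w.1.2 0 i + dot w.1.2 x + w.2)) =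
    w.1.1 \*: (cos \o g) by [].
have dg : is_derive (0 : R) 1 g (w.1.2 0 i).
  by apply: is_derive_eq; rewrite scaler0 !addr0 add0r; exact: mulr1.
apply: (is_derive_eq
  (is_deriveZ w.1.1 (is_derive1_comp (is_derive_cos (g 0)) dg))).
by rewrite /g mul0r add0r -mulrA [_ * - _]mulrC.
Qed.

Lemma partial_trig i s : partial i (trig s) = trig (dtrig i s).
Proof. by apply/funext => x; have [_] := is_derive_trig s i x. Qed.

Lemma smooth_trig s : smooth (trig s).
Proof.
move=> l.
have -> : foldr (@partial R) (trig s) l = trig (foldr dtrig s l).
  by elim: l => //= i l ->; rewrite partial_trig.
split; first exact: continuous_trig.
by move=> i x; have [] := is_derive_trig (foldr dtrig s l) i x.
Qed.

Lemma hessian_trig s x :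
  hessian (trig s) x = \matrix_(i, j) - \sum_(w <- s)
    w.1.2 0 i * w.1.2 0 j * (w.1.1 * cos (dot w.1.2 x + w.2)).
Proof.
apply/matrixP => i j.
rewrite !mxE !partial_trig /trig /dtrig !big_map /= -sumrN.
apply: eq_bigr => w _.
by rewrite -!addrA -splitr addrA cosDpi; ring.
Qed.

Lemma periodic_trig s i :
  (forall w, w \in s -> exists m : nat, w.1.2 0 i = m%:R) ->
  periodic (trig s) ((2 * pi) *: delta_mx 0 i).
Proof.
move=> ks x; apply: eq_big_seq => w /ks[m wm].
congr (_ * _); rewrite dotD dotZ dot_delta wm addrAC.
rewrite -[RHS](periodicn (@cosD2pi R) m).
by congr cos; ring.
Qed.

(** The amplitudes are - 1 because the Hessian of - cos (k . x) is
cos (k . x) k k^T. *)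
Definition potential : 'rV[R]_3 -> R :=
  trig [seq (-1, k, 0) : wave |
        k <- [:: delta_mx 0 0; delta_mx 0 1; delta_mx 0 2; const_mx 1]].

Lemma smooth_torus_potential : smooth_torus potential.
Proof.
split; first exact: smooth_trig.
move=> i; apply: periodic_trig => w /mapP[k].
rewrite !inE => /or4P[] /eqP -> -> /=; rewrite mxE; [..|by exists 1%N].
all: by eexists.
Qed.

Lemma hessian_potential x :
  hessian potential x = \matrix_(i, j)
    ((if i == j then cos (x 0 i) else 0) + cos (x 0 0 + x 0 1 + x 0 2)).
Proof.
have dotb i : dot (delta_mx 0 i) x = x 0 i.
  by rewrite -dot_delta /dot; apply: eq_bigr => j _; rewrite mulrC.
have dot1 : dot (const_mx 1) x = x 0 0 + x 0 1 + x 0 2.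
  rewrite /dot !big_ord_recl big_ord0 !mxE !mul1r addr0 addrA.
  by congr (_ + x 0 _ + x 0 _); apply: val_inj.
rewrite /= hessian_trig; apply/matrixP => i j; rewrite !mxE.
rewrite !big_cons big_nil /= !dotb dot1 !mxE !addr0.
case: i => [[|[|[|//]]] i3]; case: j => [[|[|[|//]]] j3];
  rewrite /eq_op /= ?mul0r ?mulr0 ?mul1r ?mulN1r ?mul0r.
all: try by ring.
- by rewrite (_ : Ordinal i3 = 0); [ring|exact: val_inj].
- by rewrite (_ : Ordinal i3 = 1); [ring|exact: val_inj].
- by rewrite (_ : Ordinal i3 = 2); [ring|exact: val_inj].
Qed.

Lemma energy_hessian_potential x :
  energy (hessian potential x) =
  quartic (cos (x 0 0)) (cos (x 0 1)) (cos (x 0 2))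
    (cos (x 0 0 + x 0 1 + x 0 2)) 0 0.
Proof.
rewrite hessian_potential /energy !mxE /=.
by congr quartic; rewrite /eq_op/=; ring.
Qed.

End TrigonometricSums.

(** * Integration over the torus *)

Lemma integral_setX d1 d2 (T1 : measurableType d1) (T2 : measurableType d2)
    (R : realType) (m1 : {sigma_finite_measure set T1 -> \bar R})
    (m2 : {sigma_finite_measure set T2 -> \bar R}) (A : set T1) (B : set T2)
    (f : T1 * T2 -> \bar R) : measurable A -> measurable B ->
  (m1 \x m2)%E.-integrable (A `*` B) f ->
  (\int[m1 \x m2]_(z in A `*` B) f z =
   \int[m1]_(x in A) \int[m2]_(y in B) f (x, y))%E.
Proof.
move=> mA mB fi.
rewrite integral_mkcond -integral12_prod_meas1; last first.
  by rewrite -integrable_mkcond//; exact: measurableX.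
rewrite [RHS]integral_mkcond; apply: eq_integral => x _.
rewrite /fubini_F [RHS]/patch; case: ifPn => xA; last first.
  apply: integral0_eq => y _; rewrite /patch; case: ifPn => //.
  by rewrite in_setX/= (negbTE xA).
rewrite [RHS]integral_mkcond; apply: eq_integral => y _.
by rewrite /patch in_setX/= xA.
Qed.

Lemma bounded_integrable d (T : measurableType d) (R : realType)
    (m : {measure set T -> \bar R}) (A : set T) (f : T -> R) M :
  measurable A -> (m A < +oo)%E -> measurable_fun setT f ->
  (forall z, `|f z| <= M) -> m.-integrable A (EFin \o f).
Proof.
move=> mA Afin mf bf; apply: measurable_bounded_integrable => //.
  exact: measurable_funTS.
by exists M; split=> [|N MN z _]; [exact: num_real|exact: le_trans (ltW MN)].
Qed.

Section TorusIntegrals.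
Variable R : realType.
Local Notation mu := (@lebesgue_measure R).
Local Notation I := (`[0, 2 * pi]%classic : set R).
Local Notation plane := (measurableTypeR R * measurableTypeR R)%type.
Local Notation triple := (plane * measurableTypeR R)%type.

(** The antiderivative comes from
cos t * cos (t + b) = (cos b + cos (2 t + b)) / 2. *)
Lemma integral_coscos (c b : R) :
  (\int[mu]_(t in I) (c * (cos t * cos (t + b)))%:E = (pi * (c * cos b))%:E)%E.
Proof.
pose G (t : R) : R := c * (t * cos b / 2 + sin (t * 2 + b) / 4).
have dG (t : R) : is_derive t 1 G (c * (cos t * cos (t + b))).
  pose l t : R := t * 2 + b.
  have dl : is_derive t 1 l 2.
    by apply: is_derive_eq; rewrite scaler0 add0r addr0; exact: mulr1.
  have := is_derive1_comp (is_derive_sin (l t)) dl.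
  have -> : G = c \*: ((cos b / 2) \*: id + 4^-1 \*: (sin \o l)).
    apply/funext => u.
    transitivity (c * (cos b / 2 * u + 4^-1 * sin (l u))) => //.
    by rewrite /G /l; ring.
  move=> d1; apply: is_derive_eq.
  rewrite /GRing.scale /= /l.
  have -> : t * 2 + b = t + (t + b) by ring.
  have -> : cos b = cos (t + b - t) by congr cos; ring.
  move: (t + b) => u; rewrite cosB cosD.
  by field.
have cts : continuous (fun t : R => c * (cos t * cos (t + b))).
  move=> t; apply: (cvgM (cvg_cst c)); apply: (cvgM (@continuous_cos R t)).
  have st : {for t, continuous (fun u : R => u + b)}.
    by apply: (@continuousD _ _ _ id); [exact: id|exact: cst_continuous].
  exact: (continuous_comp st (@continuous_cos _ _)).
have GC : continuous G.
  move=> t; apply: differentiable_continuous; apply/derivable1_diffP.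
  by case: (dG t).
have pi2 : 0 < 2 * pi :> R by rewrite mulr_gt0// pi_gt0.
rewrite (@continuous_FTC2 R (fun t => c * (cos t * cos (t + b))) G 0 (2 * pi))//.
- rewrite -EFinB; congr (_%:E).
  have -> : G (2 * pi) = c * (pi * cos b + sin b / 4).
    rewrite /G; congr (_ * (_ + _ / 4)).
      by rewrite -[2 * pi * cos b]mulrA mulrC mulKf ?pnatr_eq0.
    by rewrite -[RHS](periodicn (@sinD2pi R) 2); congr sin; ring.
  by rewrite /G !mul0r !add0r; ring.
- exact: continuous_subspaceT.
- split; first by move=> t _; case: (dG t).
  + exact/cvg_at_right_filter/GC.
  + exact/cvg_at_left_filter/GC.
- by move=> t _; rewrite derive1E; case: (dG t).
Qed.

Lemma measurable_period : measurable (I : set (measurableTypeR R)).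
Proof. exact: measurable_itv. Qed.

Lemma measurable_cell : measurable (@torus_cell R : set triple).
Proof. by apply: measurableX => //; apply: measurableX. Qed.

Lemma lebesgue_period : mu I = (2 * pi)%:E.
Proof.
rewrite lebesgue_measure_itv /= lte_fin mulr_gt0 ?pi_gt0//.
by rewrite -EFinB subr0.
Qed.

(** A name of its own lets the product measure carry the sigma-finite structure
that the integration over the triple product requires. *)
Definition area : set plane -> \bar R := (mu \x mu)%E.

HB.instance Definition _ := Measure.on area.

Lemma sigma_finite_area : sigma_finite setT area.
Proof.
have /sigma_finiteP[F [TF ndF Foo]] := sigma_finiteT mu.
exists (fun n => F n `*` F n) => [|n].
  apply/esym/seteqP; split=> // -[x y] _.
  have [[n _ Fx] [k _ Fy]] : (\bigcup_n F n) x /\ (\bigcup_n F n) y.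
    by rewrite -TF.
  exists (maxn n k) => //; split=> /=.
    by apply: (subsetPset _ _ (ndF _ _ (leq_maxl n k))).
  by apply: (subsetPset _ _ (ndF _ _ (leq_maxr n k))).
have [mF Fn] := Foo n; split; first exact: measurableX.
by rewrite /area product_measure1E// lte_mul_pinfty// ge0_fin_numE.
Qed.

HB.instance Definition _ :=
  Measure_isSigmaFinite.Build _ _ _ area sigma_finite_area.

Lemma lebesgue3E : lebesgue3 R = (area \x mu)%E :> (set triple -> \bar R).
Proof. by []. Qed.

Lemma area_period : area (I `*` I) = (4 * pi ^+ 2)%:E.
Proof.
rewrite /area product_measure1E//=; rewrite lebesgue_period -EFinM.
by congr (_%:E); ring.
Qed.

Lemma lebesgue3_cell : lebesgue3 R (@torus_cell R) = (8 * pi ^+ 3)%:E.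
Proof.
transitivity (area (I `*` I) * mu I)%E.
  by apply: product_measure1E => //; exact: measurableX.
by rewrite area_period lebesgue_period -EFinM; congr (_%:E); ring.
Qed.

Lemma bounded_integrable_cell (f : triple -> R) M : measurable_fun setT f ->
  (forall z, `|f z| <= M) ->
  (lebesgue3 R).-integrable (@torus_cell R) (EFin \o f).
Proof.
apply: bounded_integrable; first exact: measurable_cell.
by rewrite lebesgue3_cell ltry.
Qed.

Lemma measurable_cos : measurable_fun setT (@cos R).
Proof. exact: continuous_measurable_fun (@continuous_cos R). Qed.

Lemma norm_cos_le1 (x : R) : `|cos x| <= 1.
Proof. by rewrite ler_norml cos_geN1 cos_le1. Qed.

Lemma measurable_waves :
  [/\ measurable_fun setT (fun z : triple => cos z.1.1),
      measurable_fun setT (fun z : triple => cos z.1.2),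
      measurable_fun setT (fun z : triple => cos z.2) &
      measurable_fun setT (fun z : triple => cos (z.1.1 + z.1.2 + z.2))].
Proof.
have m1 : measurable_fun setT (fun z : triple => z.1.1).
  exact: (measurableT_comp measurable_fst measurable_fst).
have m2 : measurable_fun setT (fun z : triple => z.1.2).
  exact: (measurableT_comp measurable_snd measurable_fst).
split; apply: (measurableT_comp measurable_cos) => //.
by do 2?apply: measurable_funD.
Qed.

Definition wave_product (z : triple) : R :=
  cos z.1.1 * cos z.1.2 * cos z.2 * cos (z.1.1 + z.1.2 + z.2).

Lemma measurable_wave_product : measurable_fun setT wave_product.
Proof.
by have [m1 m2 m3 m4] := measurable_waves; do 3?apply: measurable_funM.
Qed.

Lemma norm_wave_product_le1 z : `|wave_product z| <= 1.
Proof.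
by rewrite /wave_product !normrM !mulr_ile1 ?mulr_ge0 ?norm_cos_le1.
Qed.

(** Integrating out one variable at a time, each step is an instance of
[integral_coscos] and yields a factor pi. *)
Lemma integral_wave_product :
  \int[lebesgue3 R]_(z in @torus_cell R) wave_product z = pi ^+ 3.
Proof.
have iP := bounded_integrable_cell measurable_wave_product norm_wave_product_le1.
have mI := measurable_period.
rewrite lebesgue3E in iP.
have E1 : (\int[lebesgue3 R]_(z in @torus_cell R) (wave_product z)%:E =
    \int[area]_(w in I `*` I) \int[mu]_(t in I) (wave_product (w, t))%:E)%E.
  rewrite lebesgue3E.
  exact: (@integral_setX _ _ _ _ R area mu (I `*` I) I
    (EFin \o wave_product) (measurableX mI mI) mI iP).
pose Q (w : plane) : R := pi * (cos w.1 * cos w.2 * cos (w.1 + w.2)).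
have iQ : (mu \x mu)%E.-integrable (I `*` I) (EFin \o Q).
  apply: (@bounded_integrable _ _ _ _ _ _ pi); first exact: measurableX.
  - by rewrite -[X in (X < _)%E]/(area (I `*` I)) area_period ltry.
  - apply: measurable_funM => //; apply: measurable_funM.
      by apply: measurable_funM; apply: (measurableT_comp measurable_cos).
    by apply: (measurableT_comp measurable_cos); exact: measurable_funD.
  - move=> w; rewrite /Q normrM ger0_norm ?pi_ge0// ler_piMr ?pi_ge0//.
    by rewrite !normrM !mulr_ile1 ?mulr_ge0 ?norm_cos_le1.
have E2 : (\int[area]_(w in I `*` I) (Q w)%:E =
    \int[mu]_(x in I) \int[mu]_(y in I) (Q (x, y))%:E)%E.
  exact: (integral_setX mI mI iQ).
rewrite /Rintegral E1.
have -> : (\int[area]_(w in I `*` I)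
      \int[mu]_(t in I) (wave_product (w, t))%:E =
    \int[area]_(w in I `*` I) (Q w)%:E)%E.
  apply: eq_integral => w _; rewrite -integral_coscos.
  by apply: eq_integral => t _; rewrite /wave_product/= [t + _]addrC mulrA.
rewrite E2.
have -> : (\int[mu]_(x in I) \int[mu]_(y in I) (Q (x, y))%:E =
    \int[mu]_(x in I) (pi ^+ 2 * (cos x * cos (x + 0)))%:E)%E.
  apply: eq_integral => x _.
  have -> : pi ^+ 2 * (cos x * cos (x + 0)) = pi * (pi * cos x * cos x).
    by rewrite addr0; ring.
  rewrite -integral_coscos.
  by apply: eq_integral => t _; rewrite /Q/= [t + _]addrC !mulrA.
by rewrite integral_coscos cos0 /=; ring.
Qed.

(** The cosines bound the square by 16, so the numerator is at most
16 * 8 pi ^ 3 - 256 pi ^ 3 = - 128 pi ^ 3. *)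
Lemma torus_mean_energy_lt0 :
  torus_mean (fun x => energy (hessian (@potential R) x)) < 0.
Proof.
pose W (z : triple) : R := wnorm (cos z.1.1) (cos z.1.2) (cos z.2)
  (cos (z.1.1 + z.1.2 + z.2)) 0 0.
have W0 z : 0 <= W z by exact: wnorm_ge0.
have W4 z : W z <= 4.
  have c1 (x : R) : cos x ^+ 2 <= 1.
    by rewrite -real_normK ?num_real// exprn_ile1 ?norm_cos_le1.
  rewrite /W /wnorm expr0n addr0 mulr0 addr0.
  by rewrite (_ : 4 = 1 + 1 + 1 + 1) ?lerD//; ring.
have W16 z : W z ^+ 2 <= 16.
  by rewrite (_ : 16 = 4 ^+ 2) ?lerXn2r ?nnegrE//; ring.
have mW : measurable_fun setT (fun z => W z ^+ 2).
  have [m1 m2 m3 m4] := measurable_waves.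
  apply: measurable_funX; apply: measurable_funD => //.
  by do 3?apply: measurable_funD; apply: measurable_funX.
have mcell := measurable_cell.
have iW : (lebesgue3 R).-integrable (@torus_cell R)
    (EFin \o (fun z => W z ^+ 2)).
  by apply: (bounded_integrable_cell mW (M := 16)) => z; rewrite ger0_norm ?sqr_ge0.
have iP := bounded_integrable_cell measurable_wave_product norm_wave_product_le1.
have iP256 : (lebesgue3 R).-integrable (@torus_cell R)
    (EFin \o (fun z => 256 * wave_product z)).
  apply: (@bounded_integrable_cell _ 256).
    by apply: measurable_funM => //; exact: measurable_wave_product.
  by move=> z; rewrite normrM ger0_norm// ler_piMr ?norm_wave_product_le1.
have vol : fine (lebesgue3 R (@torus_cell R)) = 8 * pi ^+ 3.
  by rewrite lebesgue3_cell.
have pi3 : 0 < pi ^+ 3 :> R by rewrite exprn_gt0 ?pi_gt0.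
rewrite /torus_mean vol pmulr_rlt0; last by rewrite invr_gt0 mulr_gt0.
have -> : \int[lebesgue3 R]_(z in @torus_cell R)
      energy (hessian (@potential R) (row3 z)) =
    \int[lebesgue3 R]_(z in @torus_cell R)
      (W z ^+ 2 - 256 * wave_product z).
  apply: eq_Rintegral => z _.
  by rewrite energy_hessian_potential /row3 !mxE.
rewrite RintegralB// RintegralZl// integral_wave_product.
have : \int[lebesgue3 R]_(z in @torus_cell R) W z ^+ 2 <= 16 * (8 * pi ^+ 3).
  rewrite -vol -Rintegral_cst//; apply: le_Rintegral => //.
  by apply: (@bounded_integrable_cell _ 16) => // z; rewrite ger0_norm.
lra.
Qed.

End TorusIntegrals.

Theorem theorem1p5 (R : realType) :
  exists F : 'M[R]_3 -> R,
    quartic_on_sym F /\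
    sym_rank_one_convex F /\
    exists Psi : 'rV[R]_3 -> R,
      smooth_torus Psi /\
      torus_mean (fun x => F (hessian Psi x)) < F 0.
Proof.
exists (@energy R); split; first exact: energy_quartic_on_sym.
split; first exact: energy_rank_one_convex.
exists (@potential R); split; first exact: smooth_torus_potential.
by rewrite energy0; exact: torus_mean_energy_lt0.
Qed.
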